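(* Let $R$ be an associative ring with identity, let $a\in R$ and let $e^2=e\in R$ be an idempotent. Then the following statements are equivalent: (1) $eae$ is strongly $\pi$-regular in $eRe$; (2) $ae+1-e$ is strongly $\pi$-regular in $R$; (3) $ea+1-e$ is strongly $\pi$-regular in $R$.
   Context: The corner ring $eRe$ is regarded as a ring with identity $e$. An element $x$ of a ring $S$ is strongly $\pi$-regular in $S$ if $x^n\in x^{n+1}S\cap Sx^{n+1}$ for some positive integer $n$. *)

(* Defs.v *)
From HB Require Import structures.
From mathcomp Require Import all_boot all_algebra.

Set Implicit Arguments.
Unset Strict Implicit.
Unset Printing Implicit Defensive.

Import GRing.Theory.
Local Open Scope ring_scope.

Definition strongly_pi_regular (S : pzRingType) (x : S) : Prop :=
  exists n : nat, [/\ (0 < n)%N,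
    exists y : S, x ^+ n = x ^+ n.+1 * y &
    exists z : S, x ^+ n = z * x ^+ n.+1].

(* For idempotent e, the set eRe = {e r e | r in R} is the set of fixed points
   of x |-> e x e (see in_cornerP); the latter is a boolean condition, so that
   the subtype below inherits the algebraic structure of R. *)
Definition in_corner (R : pzRingType) (e : R) : pred R :=
  [pred x | e * x * e == x].

Lemma corner_mem (R : pzRingType) (e : R) (he : e ^+ 2 = e) (r : R) :
  e * r * e \in in_corner e.
Proof.
by rewrite inE -[e * (e * r * e) * e]mulrA !mulrA -expr2 he -!mulrA -expr2 he.
Qed.

Lemma in_cornerP (R : pzRingType) (e : R) (he : e ^+ 2 = e) (x : R) :
  reflect (exists r, x = e * r * e) (x \in in_corner e).
Proof.
apply: (iffP idP) => [/eqP hx|[r ->]]; last exact: corner_mem.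
by exists x.
Qed.

(* The type depends on the proof that e is idempotent, which is needed for the
   ring structure. *)
Record corner (R : pzRingType) (e : R) (he : e ^+ 2 = e) := Corner {
  corner_val : R;
  corner_valP : corner_val \in in_corner e
}.

HB.instance Definition _ (R : pzRingType) (e : R) (he : e ^+ 2 = e) :=
  [isSub for @corner_val R e he].
HB.instance Definition _ (R : pzRingType) (e : R) (he : e ^+ 2 = e) :=
  [Choice of corner he by <:].

Lemma in_corner_zmod_closed (R : pzRingType) (e : R) :
  zmod_closed (in_corner e).
Proof.
split=> [|x y]; first by rewrite inE mulr0 mul0r.
by rewrite !inE mulrBr mulrBl => /eqP-> /eqP->.
Qed.

HB.instance Definition _ (R : pzRingType) (e : R) :=
  GRing.isZmodClosed.Build R (in_corner e) (in_corner_zmod_closed e).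
HB.instance Definition _ (R : pzRingType) (e : R) (he : e ^+ 2 = e) :=
  [SubChoice_isSubZmodule of corner he by <:].

(* The canonical map r |-> e r e from R to eRe. *)
Definition to_corner (R : pzRingType) (e : R) (he : e ^+ 2 = e) (r : R) :
  corner he := Corner he (corner_mem he r).

Lemma in_corner_one (R : pzRingType) (e : R) (he : e ^+ 2 = e) :
  e \in in_corner e.
Proof. by rewrite inE -expr2 he -expr2 he. Qed.

Lemma in_cornerE (R : pzRingType) (e : R) (he : e ^+ 2 = e) (x : R) :
  x \in in_corner e -> e * x = x /\ x * e = x.
Proof.
move=> /eqP hx; split; rewrite -hx; first by rewrite !mulrA -expr2 he.
by rewrite -!mulrA -expr2 he.
Qed.

Lemma in_corner_mul (R : pzRingType) (e : R) (he : e ^+ 2 = e) (x y : R) :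
  x \in in_corner e -> y \in in_corner e -> x * y \in in_corner e.
Proof.
move=> /(in_cornerE he)[hx _] /(in_cornerE he)[_ hy].
by rewrite inE mulrA hx -mulrA hy.
Qed.

Definition corner_one (R : pzRingType) (e : R) (he : e ^+ 2 = e) : corner he :=
  Corner he (in_corner_one he).

Definition corner_mul (R : pzRingType) (e : R) (he : e ^+ 2 = e)
  (x y : corner he) : corner he :=
  Corner he (in_corner_mul he (corner_valP x) (corner_valP y)).

Lemma corner_mulA (R : pzRingType) (e : R) (he : e ^+ 2 = e) :
  associative (@corner_mul R e he).
Proof. by move=> x y z; apply: val_inj; rewrite /= mulrA. Qed.

Lemma corner_mul1r (R : pzRingType) (e : R) (he : e ^+ 2 = e) :
  left_id (corner_one he) (@corner_mul R e he).
Proof.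
by move=> x; apply: val_inj; have [] := in_cornerE he (corner_valP x).
Qed.

Lemma corner_mulr1 (R : pzRingType) (e : R) (he : e ^+ 2 = e) :
  right_id (corner_one he) (@corner_mul R e he).
Proof.
by move=> x; apply: val_inj; have [] := in_cornerE he (corner_valP x).
Qed.

Lemma corner_mulDl (R : pzRingType) (e : R) (he : e ^+ 2 = e) :
  left_distributive (@corner_mul R e he) +%R.
Proof. by move=> x y z; apply: val_inj; rewrite /= mulrDl. Qed.

Lemma corner_mulDr (R : pzRingType) (e : R) (he : e ^+ 2 = e) :
  right_distributive (@corner_mul R e he) +%R.
Proof. by move=> x y z; apply: val_inj; rewrite /= mulrDr. Qed.

HB.instance Definition _ (R : pzRingType) (e : R) (he : e ^+ 2 = e) :=
  GRing.Zmodule_isPzRing.Build (corner he) (@corner_mulA R e he)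
    (@corner_mul1r R e he) (@corner_mulr1 R e he)
    (@corner_mulDl R e he) (@corner_mulDr R e he).

Lemma val_corner1 (R : pzRingType) (e : R) (he : e ^+ 2 = e) :
  val (1 : corner he) = e.
Proof. by []. Qed.

Lemma val_cornerM (R : pzRingType) (e : R) (he : e ^+ 2 = e) (x y : corner he) :
  val (x * y) = val x * val y.
Proof. by []. Qed.

(* Main.v *)
Require Import Defs.
From mathcomp Require Import all_boot all_algebra.
Local Open Scope ring_scope.

(** With [f = 1 - e], the elements [a e + f], [e a + f] and [e a e + f] are
    [1 - (1 - a) e], [1 - e (1 - a)] and [1 - e (1 - a) e].  Strong
    pi-regularity satisfies Jacobson's lemma, i.e. it passes between
    [1 - u v] and [1 - v u], so all three elements are strongly pi-regular in R
    simultaneously; and [x |-> x + f] is a monoid embedding of eRe into R that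
    preserves and reflects strong pi-regularity. *)

Import GRing.Theory.

Lemma exprBM_intertwine (R : pzRingType) (u v : R) (n : nat) :
  (1 - v * u) ^+ n * v = v * (1 - u * v) ^+ n.
Proof.
elim: n => [|n IHn]; first by rewrite !expr0 mul1r mulr1.
have step : (1 - v * u) * v = v * (1 - u * v).
  by rewrite mulrBl mulrBr mul1r mulr1 mulrA.
by rewrite exprSr -mulrA step mulrA IHn -mulrA -exprSr.
Qed.

(** Multiply [(1 - v * u) ^+ n] by [1 = (1 - v * u) + v * u] and move [v] to the left through the
    power. This exposes a power of [1 - u * v], to which a hypothesis on that element applies. *)
Lemma exprBM_decomp (R : pzRingType) (u v : R) (n : nat) :
  (1 - v * u) ^+ n = (1 - v * u) ^+ n.+1 + v * (1 - u * v) ^+ n * u.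
Proof.
by rewrite -exprBM_intertwine exprSr -mulrA -mulrDr subrK mulr1.
Qed.

Lemma strongly_pi_regular_jacobson (R : pzRingType) (u v : R) :
  strongly_pi_regular (1 - u * v) -> strongly_pi_regular (1 - v * u).
Proof.
move=> [n [n_gt0 [y hy] [z hz]]]; exists n; split=> //.
(* Substituting [hy] in the decomposition turns its last term into
   [v * (1 - u * v) ^+ n.+1 * y * u]; intertwining then brings [(1 - v * u) ^+ n.+1] out on the
   left, leaving this witness. The exponent does not change. *)
- exists (1 + v * y * u).
  rewrite [LHS]exprBM_decomp hy mulrDr mulr1 mulrA -exprBM_intertwine.
  by rewrite !mulrA exprBM_intertwine.
(* Symmetrically, with the intertwining relation for [u] and [v] swapped. *)
- exists (1 + v * z * u).
  rewrite [LHS]exprBM_decomp hz mulrDl mul1r -!mulrA.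
  by rewrite exprBM_intertwine.
Qed.

Lemma strongly_pi_regular_jacobsonE (R : pzRingType) (u v : R) :
  strongly_pi_regular (1 - u * v) <-> strongly_pi_regular (1 - v * u).
Proof. by split; apply: strongly_pi_regular_jacobson. Qed.

Section CornerEmbedding.

Variables (R : pzRingType) (e : R) (he : e ^+ 2 = e).
Implicit Types x y : corner he.

(** In the Peirce decomposition for [e] this is the block-diagonal element diag(x, 1). *)
Definition corner_embed x : R := val x + (1 - e).

Lemma mul_e_corner_embed x : e * corner_embed x = val x.
Proof.
have [ex _] := in_cornerE he (corner_valP x).
by rewrite mulrDr ex mulrBr mulr1 -expr2 he subrr addr0.
Qed.

Lemma mul_corner_embed_e x : corner_embed x * e = val x.
Proof.
have [_ xe] := in_cornerE he (corner_valP x).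
by rewrite mulrDl xe mulrBl mul1r -expr2 he subrr addr0.
Qed.

Lemma corner_embed1 : corner_embed 1 = 1.
Proof. by rewrite /corner_embed val_corner1 addrC subrK. Qed.

Lemma corner_embedM x y : corner_embed (x * y) = corner_embed x * corner_embed y.
Proof.
have [ey _] := in_cornerE he (corner_valP y).
have mul_val : corner_embed x * val y = val x * val y.
  by rewrite -[X in _ * X = _]ey mulrA mul_corner_embed_e.
rewrite [corner_embed y]/corner_embed mulrDr mul_val mulrBr mulr1.
rewrite mul_corner_embed_e {1 2}/corner_embed val_cornerM.
by rewrite [val x + _ - _]addrAC subrr add0r.
Qed.

Lemma corner_embedX x n : corner_embed (x ^+ n) = corner_embed x ^+ n.
Proof.
elim: n => [|n IHn]; first by rewrite !expr0 corner_embed1.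
by rewrite !exprS corner_embedM IHn.
Qed.

Lemma strongly_pi_regular_corner_embed x :
  strongly_pi_regular x <-> strongly_pi_regular (corner_embed x).
Proof.
split=> -[n [n_gt0 [y hy] [z hz]]]; exists n; split=> //.
- by exists (corner_embed y); rewrite -!corner_embedX -corner_embedM -hy.
- by exists (corner_embed z); rewrite -!corner_embedX -corner_embedM -hz.
(* The witness [y] may lie outside the corner, so it is compressed to [e * y * e]: multiplying [hy]
   by [e] on both sides removes the summand [1 - e] and leaves an identity between elements of the
   corner. *)
- exists (to_corner he y); apply: val_inj; rewrite val_cornerM /=.
  have [_ xe] := in_cornerE he (corner_valP (x ^+ n.+1)).
  have [_ xne] := in_cornerE he (corner_valP (x ^+ n)).
  rewrite !mulrA xe -[LHS]xne -[X in X * e = _]mul_e_corner_embed.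
  by rewrite corner_embedX hy mulrA -corner_embedX mul_e_corner_embed.
- exists (to_corner he z); apply: val_inj; rewrite val_cornerM /=.
  have [ex _] := in_cornerE he (corner_valP (x ^+ n.+1)).
  have [exn _] := in_cornerE he (corner_valP (x ^+ n)).
  rewrite -!mulrA ex -[LHS]exn -[X in e * X = _]mul_corner_embed_e.
  by rewrite corner_embedX hz -mulrA -corner_embedX mul_corner_embed_e.
Qed.

End CornerEmbedding.

Arguments corner_embed {R e he} x.

Theorem theorem3p2 (R : pzRingType) (a e : R) (he : e ^+ 2 = e) :
  (strongly_pi_regular (to_corner he a) <->
     strongly_pi_regular (a * e + 1 - e)) /\
  (strongly_pi_regular (a * e + 1 - e) <->
     strongly_pi_regular (e * a + 1 - e)).
Proof.
have ae_jacobson : a * e + 1 - e = 1 - (1 - a) * e.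
  by rewrite mulrBl mul1r opprB addrA [1 + _]addrC.
have ea_jacobson : e * a + 1 - e = 1 - e * (1 - a).
  by rewrite mulrBr mulr1 opprB addrA [1 + _]addrC.
have eae_jacobson : corner_embed (to_corner he a) = 1 - e * ((1 - a) * e).
  rewrite mulrBl mul1r mulrBr -expr2 he mulrA opprB /corner_embed /=.
  by rewrite addrCA.
split; last by rewrite ae_jacobson ea_jacobson; apply: strongly_pi_regular_jacobsonE.
apply: iff_trans (strongly_pi_regular_corner_embed _ _ _ _) _.
(* The duplicated [e] can be swapped with [(1 - a) * e] by Jacobson's lemma, which gives
   [e * ((1 - a) * e)]. *)
have ee_absorb : (1 - a) * e = (1 - a) * e * e by rewrite -mulrA -expr2 he.
rewrite eae_jacobson ae_jacobson [in X in _ <-> X]ee_absorb.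
exact: strongly_pi_regular_jacobsonE.
Qed.
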